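(* Let $P$ be a (Borel) probability measure on a separable Hilbert space $\mathbb{H}$ over the field $\mathbb{R}$. Let $\psi:\mathbb{R}^{+}\to[0,1]$ be a bounded continuous, strictly decreasing and positive definite function (e.g. $\psi(t)=e^{-t^2}$), such that $k(x,y)=\psi(\|x-y\|_{\mathbb{H}})$ is a translation-invariant characteristic kernel on $\mathbb{H}$, and let $m_P$ be the kernel mean embedding of $P$ for the kernel $k$. If $m_P(y_2)>m_P(y_1)$ for some $y_1,y_2\in\mathbb{H}$, then there exist open balls of the same size $B_r(y_1)$ and $B_r(y_2)$ (with $r>0$) such that $P(B_r(y_2))>P(B_r(y_1))$, and $r$ depends only on the difference $m_P(y_2)-m_P(y_1)$ and the characteristic kernel $k$ itself.
   Context: $\mathbb{R}^+=[0,\infty)$ and $B_r(y)=\{x\in\mathbb{H}:\|x-y\|_{\mathbb{H}}<r\}$. A function $k:\mathbb{H}\times\mathbb{H}\to\mathbb{R}$ is a positive definite kernel if it is symmetric and $\sum_{i,j=1}^n a_ia_jk(x_i,x_j)\ge 0$ for all $n\in\mathbb{N}$, $a_i\in\mathbb{R}$, $x_i\in\mathbb{H}$; it is strictly positive definite if equality (for distinct $x_i$) implies $a_1=\dots=a_n=0$. It is translation-invariant if $k(x,y)$ is a function of $x-y$ only. That $\psi$ is positive definite means that $(x,y)\mapsto\psi(\|x-y\|_{\mathbb{H}})$ is a positive definite kernel. $\mathcal{H}_k$ denotes the reproducing kernel Hilbert space of $k$. The kernel mean embedding (kernel mean function) of a probability measure $P$ is $m_P(\cdot)=\int_{\mathbb{H}}k(x,\cdot)\,P(dx)\in\mathcal{H}_k$.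 A strictly positive definite kernel $k$ is characteristic for a family of measures $\mathscr{P}$ if the map $\mathscr{P}\to\mathcal{H}_k$, $P\mapsto m_P$, is injective; ''characteristic'' without further qualification refers to the family of all Borel probability measures on $\mathbb{H}$.
   Formalization: A single r determined by m_P(y2)-m_P(y1) and k cannot exist in general (a point mass at 0 gives two pairs with equal difference and incompatible r); proved instead: r can be chosen from a finite list of radii that depends only on that difference and k. *)

(* Defs.v *)
From HB Require Import structures.
From mathcomp Require Import all_boot all_order all_algebra.
From mathcomp Require Import all_classical all_reals all_analysis.
Import Order.TTheory GRing.Theory Num.Theory.
Import numFieldNormedType.Exports.

Set Implicit Arguments.
Unset Strict Implicit.
Unset Printing Implicit Defensive.

Local Open Scope classical_set_scope.
Local Open Scope ring_scope.

(* With the completeness of [H] this makes [H] a real Hilbert space. *)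
Definition norm_from_dot (R : realType) (H : normedModType R)
    (dot : {dot H for idfun}) : Prop :=
  forall x : H, `|x| ^+ 2 = dot x x.

Definition separable (T : topologicalType) : Prop :=
  exists2 D : set T, countable D & dense D.

Notation borel T := (g_sigma_algebraType (@open T)).
Notation borel_probability H R := (probability (borel H) R).

Section kernels.
Variables (R : realType) (H : completeNormedModType R).
Implicit Types (k : H -> H -> R) (psi : R -> R).

Definition positive_definite k : Prop :=
  (forall x y, k x y = k y x) /\
  (forall (n : nat) (a : 'I_n -> R) (x : 'I_n -> H),
    0 <= \sum_(i < n) \sum_(j < n) a i * a j * k (x i) (x j)).

Definition strictly_positive_definite k : Prop :=
  positive_definite k /\
  (forall (n : nat) (a : 'I_n -> R) (x : 'I_n -> H), injective x ->
    \sum_(i < n) \sum_(j < n) a i * a j * k (x i) (x j) = 0 ->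
    forall i, a i = 0).

Definition translation_invariant k : Prop :=
  exists f : H -> R, forall x y, k x y = f (x - y).

(* Only the values of [psi] on [0, +oo[ matter. *)
Definition radial_kernel psi (x y : H) : R := psi `|x - y|.

Definition mean_embedding k (P : borel_probability H R) (y : H) : R :=
  \int[P]_x k x y.

(* A mean embedding is an element of the RKHS, that is, a function on [H], and
   equality in the RKHS is equality of functions.  Measures are compared on
   Borel sets only: the library leaves their values on nonmeasurable sets
   unconstrained, so Leibniz equality would be too strong a conclusion. *)
Definition characteristic_for (F : set (borel_probability H R)) k : Prop :=
  strictly_positive_definite k /\
  (forall P Q : borel_probability H R, F P -> F Q ->
    mean_embedding k P = mean_embedding k Q ->
    forall A : set (borel H), measurable A -> P A = Q A).

Definition characteristic k : Prop := characteristic_for setT k.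

End kernels.

(* Main.v *)
Require Import Defs.
From HB Require Import structures.
From mathcomp Require Import all_boot all_order all_algebra.
From mathcomp Require Import all_classical all_reals all_analysis.
From mathcomp Require Import measurable_realfun lra.
Import Order.TTheory GRing.Theory Num.Theory.
Import numFieldNormedType.Exports.

Local Open Scope classical_set_scope.
Local Open Scope ring_scope.

(* Layer-cake argument with finitely many layers: if 1/N < d, then the integral
   of k(x, y) differs from (1/N) * sum_{0 < j <= N} P{x | k(x, y) > j/N} by at
   most 1/N, so some superlevel set has larger measure at y2 than at y1.  Since
   psi is continuous and strictly decreasing, {x | k(x, y) > t} is the open
   ball of radius psi^-1(t) around y, unless it is empty for all y or the whole
   space for all y, in which case its measure does not depend on y. *)

(** For [0 < x] the sum counts the integers in [1, n] strictly below [x], which is the ceiling of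
    [x] minus 1; for [x = 0] it is 0. *)
Lemma count_lt_bounds (R : realFieldType) (n : nat) (x : R) : 0 <= x <= n%:R ->
  \sum_(j < n) (j.+1%:R < x)%R%:R <= x <= \sum_(j < n) (j.+1%:R < x)%R%:R + 1.
Proof.
move=> /andP[x0 xn].
(* The bound [x <= n] does not survive the induction on [n], so it is traded for an alternative:
   either all [n] thresholds lie below [x], or the upper bound already holds. *)
suff [-> hi] : \sum_(j < n) (j.+1%:R < x)%R%:R <= x /\
    (\sum_(j < n) (j.+1%:R < x)%R%:R = n%:R :> R \/
     x <= \sum_(j < n) (j.+1%:R < x)%R%:R + 1).
  by case: hi => [->|//]; lra.
elim: n {xn} => [|n [lo hi]]; first by rewrite big_ord0; split=> //; left.
rewrite big_ord_recr /= -natr1.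
have s_le_n : \sum_(j < n) (j.+1%:R < x)%R%:R <= n%:R :> R.
  rewrite -[n in leRHS]card_ord -sumr_const; apply: ler_sum => j _.
  by rewrite lern1 leq_b1.
move: (\sum_(j < n) _) lo hi s_le_n => s lo hi s_le_n.
have [nx|xn] := ltP; rewrite ?addr0/=.
  by case: hi => [->|hi]; split; [lra|left|lra|left; lra].
by split=> //; right; case: hi => [->|].
Qed.

Section layers.
Context d (T : measurableType d) (R : realType) (P : probability T R).

(** Integrate the pointwise bounds of [count_lt_bounds]: each indicator contributes the measure of
    its layer, and the error stays 1 because [P] has mass 1. *)
Lemma integral_layers (n : nat) (h : T -> R) : measurable_fun setT h ->
  (forall x, 0 <= h x <= n%:R) ->
  (\sum_(j < n) P [set x | (j.+1%:R < h x)%R] <= \int[P]_x (h x)%:E <=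
   \sum_(j < n) P [set x | (j.+1%:R < h x)%R] + 1)%E.
Proof.
move=> mh hn.
have mA (j : 'I_n) : measurable [set x | j.+1%:R < h x].
  rewrite [X in measurable X](_ : _ = setT `&` h @^-1` `]j.+1%:R, +oo[).
    exact: mh.
  by apply/seteqP; split=> x /=; rewrite in_itv/= andbT //; case.
pose S x : \bar R := (\sum_(j < n) (\1_[set x | j.+1%:R < h x] x)%:E)%E.
have SE x : S x = (\sum_(j < n) (j.+1%:R < h x)%R%:R)%:E.
  rewrite /S sumEFin; congr EFin; apply: eq_bigr => j _.
  rewrite indicE; congr (_%:R); congr nat_of_bool.
  by apply/idP/idP; rewrite inE.
have mS : measurable_fun setT S.
  apply: emeasurable_sum => j; apply/measurable_EFinP.
  exact: measurable_indic.
have S0 x : (0 <= S x)%E.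
  by rewrite SE lee_fin; apply: sumr_ge0.
have <- : (\int[P]_x S x = \sum_(j < n) P [set x | (j.+1%:R < h x)%R])%E.
  rewrite ge0_integral_sum//.
  - by apply: eq_bigr => j _; rewrite integral_indic// setIT.
  - by move=> j; apply/measurable_EFinP; exact: measurable_indic.
have mhE : measurable_fun setT (EFin \o h) by apply/measurable_EFinP.
apply/andP; split.
  apply: ge0_le_integral => // x _.
  by rewrite SE lee_fin; have /andP[] := @count_lt_bounds _ _ _ (hn x).
have <- : (\int[P]_x (S x + cst 1 x) = \int[P]_x S x + 1)%E.
  by rewrite ge0_integralD// integral_cst//= probability_setT mule1.
apply: ge0_le_integral => //.
- by move=> x _; rewrite lee_fin; have /andP[] := hn x.
- exact: emeasurable_funD.
- move=> x _; rewrite SE -EFinD lee_fin.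
  by have /andP[] := @count_lt_bounds _ _ _ (hn x).
Qed.

(** Scaling by [n] brings values in [0, 1] to the range of [integral_layers]. The upper bound is
    used for [f] and the lower one for [g], so the error 1 is paid only once. *)
Lemma Rintegral_layers_le (n : nat) (f g : T -> R) :
  measurable_fun setT f -> measurable_fun setT g ->
  (forall x, 0 <= f x <= 1) -> (forall x, 0 <= g x <= 1) ->
  (forall j, (j < n)%N ->
    (P [set x | (j.+1%:R / n%:R < f x)%R] <=
     P [set x | (j.+1%:R / n%:R < g x)%R])%E) ->
  n%:R * \int[P]_x f x <= n%:R * \int[P]_x g x + 1.
Proof.
move=> mf mg f01 g01 le_fg.
have [->|n0] := posnP n; first by rewrite !mul0r add0r ler01.
have intE (h : T -> R) : measurable_fun setT h -> (forall x, 0 <= h x <= 1) ->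
    (\int[P]_x (n%:R * h x)%:E = (n%:R * \int[P]_x h x)%:E)%E.
  move=> mh h01.
  rewrite (_ : (fun x => (n%:R * h x)%:E) = fun x => (n%:R%:E * (h x)%:E)%E) //.
  have mhE : measurable_fun setT (EFin \o h) by apply/measurable_EFinP.
  have h0 x : setT x -> (0 <= (h x)%:E)%E.
    by move=> _; rewrite lee_fin; have /andP[] := h01 x.
  rewrite ge0_integralZl_EFin// EFinM /Rintegral fineK//.
  (* [fine] loses nothing here: the integral is finite, being at most the total mass 1. *)
  rewrite ge0_fin_numE; last exact: integral_ge0.
  apply: (@le_lt_trans _ _ (\int[P]_x cst 1 x)%E); last first.
    by rewrite integral_cst//= probability_setT mule1 ltry.
  apply: ge0_le_integral => // x _.
  by rewrite lee_fin; have /andP[] := h01 x.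
have lay (h : T -> R) : measurable_fun setT h -> (forall x, 0 <= h x <= 1) ->
    (\sum_(j < n) P [set x | (j.+1%:R / n%:R < h x)%R] <=
       (n%:R * \int[P]_x h x)%:E <=
     \sum_(j < n) P [set x | (j.+1%:R / n%:R < h x)%R] + 1)%E.
  move=> mh h01; rewrite -intE//.
  have -> : (\sum_(j < n) P [set x | (j.+1%:R / n%:R < h x)%R] =
             \sum_(j < n) P [set x | (j.+1%:R < n%:R * h x)%R])%E.
    apply: eq_bigr => j _; congr (P _); apply/seteqP.
    by split=> x /=; rewrite ltr_pdivrMr ?ltr0n// mulrC.
  apply: integral_layers; first exact: measurable_funM.
  move=> x; have /andP[h0 h1] := h01 x.
  by rewrite mulr_ge0//= ler_piMr.
rewrite -lee_fin EFinD.
have /andP[_ /le_trans->//] := lay f mf f01.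
have /andP[lo _] := lay g mg g01.
apply: leeD => //; apply: le_trans lo.
by apply: lee_sum => j _; exact: le_fg.
Qed.

End layers.

Section superlevel.
Variables (R : realType) (H : completeNormedModType R) (psi : R -> R).
Hypothesis psi_cont : {within `[0, +oo[, continuous psi}.
Hypothesis psi_decr : forall s t, 0 <= s -> s < t -> psi t < psi s.

Lemma superlevel_ball (y : H) (r : R) : 0 <= r ->
  [set x | psi r < radial_kernel psi x y] = ball y r.
Proof.
move=> r0; rewrite -ball_normE; apply/seteqP.
split=> x /=; rewrite /radial_kernel distrC; last exact: psi_decr.
have [//|] := ltP `|y - x| r; rewrite le_eqVlt => /predU1P[<-|]; first by rewrite ltxx.
by move=> /(psi_decr _ _ r0) /ltW; rewrite leNgt => /negPf ->.
Qed.

(** If [psi 0 <= t], monotonicity keeps [psi] at or below [t]. Otherwise [psi] starts above [t] and,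
    by the intermediate value theorem, cannot come down to [t] without attaining it at a positive
    radius. *)
Lemma superlevel_trivial (t : R) : ~ (exists2 r, 0 < r & psi r = t) ->
  (forall y : H, [set x | t < radial_kernel psi x y] = set0) \/
  (forall y : H, [set x | t < radial_kernel psi x y] = setT).
Proof.
move=> not_val.
have [psi0t|tpsi0] := leP (psi 0) t.
  left=> y; rewrite -subset0 => x /=; rewrite /radial_kernel.
  apply/negP; rewrite -leNgt (le_trans _ psi0t)//.
  have := normr_ge0 (x - y); rewrite le_eqVlt => /predU1P[<-//|].
  by move=> /(psi_decr _ _ (lexx 0)) /ltW.
right=> y; rewrite -subTset => x _ /=; rewrite ltNge; apply/negP => psit.
have [] := @IVT R psi 0 `|x - y| t (normr_ge0 _).
- apply: continuous_subspaceW psi_cont => z /=.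
  by rewrite !in_itv /= andbT => /andP[].
- by rewrite ge_min psit orbT le_max (ltW tpsi0).
move=> c; rewrite in_itv /= => /andP[c0 _] psic; apply: not_val; exists c => //.
by rewrite lt_neqAle c0 andbT; apply/eqP => c0E; rewrite c0E psic ltxx in tpsi0.
Qed.

(** The rays above [t] generate the Borel sets of the line, and their preimages are open balls,
    empty or everything. *)
Lemma measurable_radial_kernel (y : H) :
  measurable_fun setT (fun x : borel H => radial_kernel psi x y).
Proof.
apply: (measurability _ (RGenOInfty.measurableE R)).
move=> _ [_ [t ->] <-]; rewrite setTI.
rewrite [X in measurable X](_ : _ =
    [set x : borel H | t < radial_kernel psi x y]); last first.
  by apply/seteqP; split=> x /=; rewrite in_itv /= andbT.
have [[r r0 <-]|/superlevel_trivial[|]/(_ y) ->] :=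
  pselect (exists2 r, 0 < r & psi r = t) => //.
rewrite superlevel_ball ?ltW//.
by apply: sub_gen_smallest; exact: ball_open.
Qed.

End superlevel.

(* The admissible radii form a finite list [radii d] fixed, for the given
   kernel, by the gap d = m_P(y2) - m_P(y1) alone, before P, y1 and y2. *)
Theorem corollary2 (R : realType) (H : completeNormedModType R)
  (dot : {dot H for idfun}) (dotE : norm_from_dot dot)
  (sepH : separable H)
  (psi : R -> R)
  (psi01 : forall t, 0 <= t -> 0 <= psi t <= 1)
  (psi_cont : {within `[0, +oo[, continuous psi})
  (psi_decr : forall s t, 0 <= s -> s < t -> psi t < psi s)
  (psi_pd : positive_definite (@radial_kernel R H psi))
  (k_ti : translation_invariant (@radial_kernel R H psi))
  (k_char : characteristic (@radial_kernel R H psi)) :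
  exists radii : R -> seq R,
    forall (P : borel_probability H R) (y1 y2 : H),
      let m := mean_embedding (@radial_kernel R H psi) P in
      m y1 < m y2 ->
      exists r : R, [/\ r \in radii (m y2 - m y1), 0 < r &
        (P (ball y1 r) < P (ball y2 r))%E].
Proof.
(* [Num.bound] exceeds its argument, so [layers d * d > 1]: the gap beats the layer-cake error. *)
pose layers (d : R) := Num.bound d^-1.
(* The default 0 marks a level that [psi] attains at no positive radius. *)
pose radius (d : R) j :=
  xget 0 [set r | 0 < r /\ psi r = j.+1%:R / (layers d)%:R].
exists (fun d => [seq radius d j | j <- iota 0 (layers d)]).
move=> P y1 y2 m; set d := m y2 - m y1 => m12.
apply: contrapT => no_radius.
have d0 : 0 < d by rewrite subr_gt0.
have dn : 1 < (layers d)%:R * d.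
  by rewrite -ltr_pdivrMr// mul1r; apply: archi_boundP; rewrite invr_ge0 ltW.
(* This bound would give [layers d * d <= 1]. It follows once no layer is heavier at [y2] than at
   [y1], which is what the absence of a good radius provides. *)
suff : (layers d)%:R * m y2 <= (layers d)%:R * m y1 + 1.
  by rewrite -lerBlDl -mulrBr leNgt dn.
have k01 y (x : H) : 0 <= radial_kernel psi x y <= 1 by apply: psi01.
apply: Rintegral_layers_le => //; try exact: measurable_radial_kernel.
move=> j jn; set t := j.+1%:R / (layers d)%:R.
(* At a level not attained, the layers at [y1] and [y2] are the same set. *)
have [rt|] := pselect (exists2 r, 0 < r & psi r = t); last first.
  by move=> /(superlevel_trivial R H psi psi_cont psi_decr)[|] E; rewrite !E.
have [r0 rE] : 0 < radius d j /\ psi (radius d j) = t.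
  rewrite /radius; case: xgetP => [r -> //|].
  by case: rt => r r0 rE /(_ r) [].
rewrite -rE !(superlevel_ball _ _ _ psi_decr _ _ (ltW r0)) leNgt; apply/negP => P12.
apply: no_radius; exists (radius d j); split=> //.
by apply/map_f; rewrite mem_iota.
Qed.
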